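(* The family of bases of any measurable matroid satisfies the basis axioms (B1), (B2), (B3). Conversely, if $(J,\Sigma,\mu)$ is a standard measure space and $\mathcal B\subseteq\Sigma$ satisfies the basis axioms (B1), (B2), (B3), then the family $$\mathcal F=\{F\in\Sigma\mid F\subseteq B\text{ for some }B\in\mathcal B\}$$ satisfies the independence axioms (I1)–(I4), and $(J,\Sigma,\mu,\mathcal F)$ is a measurable matroid with $\mathcal B$ as its family of bases.
   Context: A standard measure space $(J,\Sigma,\mu)$ is a standard Borel space $(J,\Sigma)$ with a finite atomless measure $\mu\colon\Sigma\to[0,\infty)$. Convention: measurable sets are identified when they differ by a $\mu$-null set: $A=B$ means $\mu(A\triangle B)=0$, $A\subseteq B$ means $\mu(A\setminus B)=0$, and families of measurable sets are families in the measure algebra (membership is unaffected by null modifications). All sets are assumed measurable. A set $X$ in a family $\mathcal X$ is maximal in $\mathcal X$ if $X\subseteq Y\in\mathcal X$ implies $Y\subseteq X$. Write $\mathcal X|Z=\{X\in\mathcal X\mid X\subseteq Z\}$. Independence axioms for $\mathcal F\subseteq\Sigma$: (I1) $\emptyset\in\mathcal F$; (I2) $F_1\subseteq F_2\in\mathcal F$ implies $F_1\in\mathcal F$; (I3) for all $X\in\Sigma$ and all maximal $F_1,F_2\in\mathcal F|X$, $\mu(F_1)=\mu(F_2)$; (I4) if $(F_i)_{i\in\mathbb N}$ is an increasing sequence in $\mathcal F$, then $\bigcup_i F_i\in\mathcal F$. A measurable matroid is a tuple $(J,\Sigma,\mu,\mathcal F)$ with $(J,\Sigma,\mu)$ a standard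 measure space and $\mathcal F$ satisfying (I1)–(I4). Its bases are the maximal members of $\mathcal F$. Basis axioms for $\mathcal B\subseteq\Sigma$: (B1) $\mathcal B$ is nonempty; (B2) for all $B_1,B_2\in\mathcal B$ and all $X\subseteq B_1\setminus B_2$, there exists $Y\subseteq B_2\setminus B_1$ such that $\mu(X)=\mu(Y)$ and $(B_1\setminus X)\cup Y\in\mathcal B$; (B3) if $(B_i)_{i\in\mathbb N}$ is a sequence in $\mathcal B$ and $B\in\Sigma$ satisfies $\lim_{n\to\infty}\mu(B_n\triangle B)=0$, then $B\in\mathcal B$. *)

(* Defs.v *)
From HB Require Import structures.
From mathcomp Require Import all_boot all_order all_algebra.
From mathcomp Require Import all_classical all_reals all_analysis.

Set Implicit Arguments.
Unset Strict Implicit.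
Unset Printing Implicit Defensive.

Import Order.TTheory GRing.Theory Num.Theory.
Import numFieldNormedType.Exports.

Local Open Scope classical_set_scope.
Local Open Scope ring_scope.
Local Open Scope ereal_scope.

Definition polish (R : realType) (P : metricType R) : Prop :=
  (exists2 D : set P, countable D & dense D) /\
  (forall u : nat -> P, cauchy (u @ \oo) -> exists l : P, u @ \oo --> l).

(* Some Polish metric, transported to T along the bijection f, has the
   measurable sets of T as its Borel sets. *)
Definition standard_borel (R : realType) (d : measure_display)
    (T : measurableType d) : Prop :=
  exists (P : metricType R) (f : P -> T),
    [/\ polish P, bijective f &
        forall A : set T, measurable A <-> <<s @open P >> (f @^-1` A)].

Definition atomless (R : realType) (d : measure_display) (T : measurableType d)
    (mu : {finite_measure set T -> \bar R}) : Prop :=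
  forall A : set T, measurable A -> 0 < mu A ->
    exists B : set T, [/\ measurable B, B `<=` A, 0 < mu B & mu B < mu A].

Definition standard_measure_space (R : realType) (d : measure_display)
    (T : measurableType d) (mu : {finite_measure set T -> \bar R}) : Prop :=
  standard_borel R T /\ atomless mu.

Section MeasurableMatroid.
Variables (R : realType) (d : measure_display) (T : measurableType d).
Variable mu : {finite_measure set T -> \bar R}.

Definition ae_subset (A B : set T) : Prop := mu (A `\` B) = 0.

(* A family in the measure algebra is represented by the set of all measurable
   representatives of its members. *)
Definition measurable_family (X : set (set T)) : Prop :=
  X `<=` measurable /\
  (forall A B : set T, measurable A -> measurable B ->
     mu (A `+` B) = 0 -> X A -> X B).

Definition maximal_in (X : set (set T)) (A : set T) : Prop :=
  X A /\ (forall B : set T, X B -> ae_subset A B -> ae_subset B A).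

Definition family_within (X : set (set T)) (Z : set T) : set (set T) :=
  [set A | X A /\ ae_subset A Z].

Record independence_axioms (F : set (set T)) : Prop := {
  indep_family : measurable_family F ;
  indep_I1 : F set0 ;
  indep_I2 : forall F1 F2 : set T, measurable F1 ->
    ae_subset F1 F2 -> F F2 -> F F1 ;
  indep_I3 : forall X F1 F2 : set T, measurable X ->
    maximal_in (family_within F X) F1 -> maximal_in (family_within F X) F2 ->
    mu F1 = mu F2 ;
  indep_I4 : forall A : nat -> set T, (forall i, F (A i)) ->
    (forall i j, (i <= j)%N -> ae_subset (A i) (A j)) -> F (\bigcup_i A i) }.

Record basis_axioms (B : set (set T)) : Prop := {
  basis_family : measurable_family B ;
  basis_B1 : B !=set0 ;
  basis_B2 : forall B1 B2 X : set T, B B1 -> B B2 ->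
    measurable X -> ae_subset X (B1 `\` B2) ->
    exists Y : set T, [/\ measurable Y, ae_subset Y (B2 `\` B1),
      mu X = mu Y & B ((B1 `\` X) `|` Y)] ;
  basis_B3 : forall (B_ : nat -> set T) (A : set T), (forall n, B (B_ n)) ->
    measurable A -> mu (B_ n `+` A) @[n --> \oo] --> 0 -> B A }.

Definition measurable_matroid (F : set (set T)) : Prop :=
  standard_measure_space mu /\ independence_axioms F.

Definition bases (F : set (set T)) : set (set T) := [set B | maximal_in F B].

Definition generated_independents (B : set (set T)) : set (set T) :=
  [set A | measurable A /\ exists2 C : set T, B C & ae_subset A C].

End MeasurableMatroid.

(* Main.v *)
Require Import Defs.
From HB Require Import structures.
From mathcomp Require Import all_boot all_order all_algebra.
From mathcomp Require Import all_classical all_reals all_analysis.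
From mathcomp Require Import lra.

Set Implicit Arguments.
Unset Strict Implicit.
Unset Printing Implicit Defensive.

Import Order.TTheory GRing.Theory Num.Theory.

Local Open Scope classical_set_scope.
Local Open Scope ring_scope.

(** Since [mu] is finite, all numerical arguments are carried out on the real
    numbers [fine (mu A)], where inclusion-exclusion identities are linear
    arithmetic.  Almost-everywhere relations are turned as early as possible
    into relations between actual sets, by changing representatives, so that
    the combinatorics becomes pointwise reasoning.

    From independent sets to bases.  An exhaustion argument ([exhaustion])
    extends every independent subset of [X] to a maximal one, so (B1) holds;
    by (I3), all bases have the same measure, and every independent set of
    that measure is a base.  To exchange [X] between [B1] and [B2]
    ([bases_exchange]), extend [B1 `\` X] to a maximal independent subset [M]
    of [(B1 `\` X) `|` B2]; as [B2] is maximal there too, (I3) gives [M] the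
    measure of a base, so [M] is a base, and what was added to [B1 `\` X] has
    the measure of [X].  For (B3), a limit in measure [A] of independent sets
    is, along a subsequence with summable errors, almost the increasing union
    of the sets [A] intersected with tail intersections of the approximants,
    so that (I2) and (I4) make it independent ([indep_limit]).

    From bases to independent sets.  Exchanging all of [C `\` D] shows that
    all members of [B] have the same measure, hence [B] is the family of bases.
    For (I3), let [C] be a base whose trace on [X] is maximal, and exchange the
    part of [C] lying outside [X] and [D] for a part [Y] of [D]: the trace of
    [C] is retained, so [Y] almost avoids [X], and
    [C `\` (D `|` X)] has at most the measure of [D `\` (C `|` X)]
    ([exchange_outside]).  When both traces are maximal these measures agree,
    and so do those of the traces.  For (I4), one follows the increasing
    sequence [A n] by bases [C n] containing it, chosen so that the remainders
    [C n `\` A n] decrease ([adapt_superset]); such bases converge in measure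
    to the union of all [A n] together with the intersection of all
    remainders, which is a base by (B3) ([generated_bigcup]). *)

(** * Sets up to null sets, and exhaustion *)

Ltac solve_measurable :=
  repeat first [assumption | apply: measurableD | apply: measurableU
               | apply: measurableI | exact: measurableT].

Section NullSets.
Variables (R : realType) (d : measure_display) (J : measurableType d).
Variable mu : {finite_measure set J -> \bar R}.
Implicit Types A B C : set J.

Local Notation m A := (fine (mu A)).

Lemma measure_fineE A : measurable A -> mu A = (m A)%:E.
Proof. by move=> mA; rewrite fineK// fin_num_measure. Qed.

Lemma eq_measure_fine A B : measurable A -> measurable B ->
  m A = m B -> mu A = mu B.
Proof. by move=> mA mB AB; rewrite measure_fineE// (measure_fineE mB) AB. Qed.

Lemma fine_measure_ge0 A : 0 <= m A.
Proof. by rewrite fine_ge0. Qed.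

Lemma le_fine_measure A B : measurable A -> measurable B ->
  A `<=` B -> m A <= m B.
Proof.
move=> mA mB AB; apply: fine_le; rewrite ?fin_num_measure//.
by apply: le_measure => //; rewrite inE.
Qed.

Lemma fine_measure_split A B : measurable A -> measurable B ->
  m A = m (A `&` B) + m (A `\` B).
Proof.
move=> mA mB; rewrite (measureDI mu mA mB) fineD 1?addrC//;
  by apply: fin_num_measure; solve_measurable.
Qed.

Lemma null_fine_measure A : measurable A -> m A <= 0 -> mu A = 0%E.
Proof.
move=> mA A0; rewrite measure_fineE//; congr (_%:E).
by apply/eqP; rewrite eq_le A0 fine_measure_ge0.
Qed.

Lemma subset_null2 A B C : measurable A -> measurable B -> measurable C ->
  A `<=` B `|` C -> mu B = 0%E -> mu C = 0%E -> mu A = 0%E.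
Proof.
move=> mA mB mC ABC B0 C0.
apply: (subset_measure0 mA _ ABC); first exact: measurableU.
by apply: null_set_setU.
Qed.

Lemma ae_subset_sub A B : A `<=` B -> ae_subset mu A B.
Proof. by rewrite -setD_eq0 /ae_subset => ->; exact: measure0. Qed.

Lemma le_fine_measure_ae A B : measurable A -> measurable B ->
  ae_subset mu A B -> m A <= m B.
Proof.
move=> mA mB AB; rewrite (fine_measure_split mA mB).
rewrite (AB : mu (A `\` B) = 0%E) addr0.
by apply: le_fine_measure; solve_measurable; apply: subIsetr.
Qed.

Lemma ae_subset_trans A B C : measurable A -> measurable B -> measurable C ->
  ae_subset mu A B -> ae_subset mu B C -> ae_subset mu A C.
Proof.
move=> mA mB mC AB BC; apply: (subset_null2 _ _ _ _ AB BC); solve_measurable.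
by move=> x [Ax nCx]; case: (pselect (B x)) => Bx; [right|left].
Qed.

(** Since [mu] is finite, maximality can be read off from the measure alone. *)
Lemma ae_subset_eq_measure A B : measurable A -> measurable B ->
  ae_subset mu A B -> m B <= m A -> ae_subset mu B A.
Proof.
move=> mA mB AB BA; apply: null_fine_measure; first by solve_measurable.
have := fine_measure_split mA mB; have := fine_measure_split mB mA.
rewrite (AB : mu (A `\` B) = 0%E) setIC /=; lra.
Qed.

(** The device by which almost-everywhere inclusions are replaced with actual
    ones throughout. *)
Lemma family_ae_eq (X : set (set J)) A B : measurable_family mu X -> X A ->
  measurable B -> ae_subset mu A B -> ae_subset mu B A -> X B.
Proof.
move=> [sX cX] XA mB AB BA; have mA := sX _ XA.
by apply: (cX A) => //; apply: null_set_setU => //; solve_measurable.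
Qed.

(** Each step realizes at least half of the gain still available.  If [E]
    contains the union [U] of the resulting sequence [S], this says
    [m (S n) + m E <= 2 * m (S n.+1) <= 2 * m U], and in the limit
    [m E <= m U]. *)
Lemma exhaustion (P : set (set J)) A : P `<=` measurable ->
  (forall S : nat -> set J, (forall n, P (S n)) ->
     (forall n, S n `<=` S n.+1) -> P (\bigcup_n S n)) ->
  P A ->
  exists M, [/\ P M, A `<=` M &
    forall E, P E -> M `<=` E -> m E <= m M].
Proof.
move=> sP cP PA.
have step (C : {C | P C}) : {D : {D | P D} | sval C `<=` sval D /\
    forall E, P E -> sval C `<=` E -> m (sval C) + m E <= 2 * m (sval D)}.
  apply: cid; case: C => C PC /=.
  set V := [set m E | E in [set E | P E /\ C `<=` E]].
  have VC : V (m C) by exists C => //; split.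
  have supV : has_sup V.
    split; first by exists (m C).
    exists (m setT) => _ [E [PE _] <-].
    by apply: le_fine_measure; [exact: sP| exact: measurableT | exact: subsetT].
  have ubV E : P E -> C `<=` E -> m E <= sup V.
    by move=> PE CE; apply: sup_upper_bound => //; exists E.
  have [CV|CV] := ltP (m C) (sup V).
    have gap : 0 < (sup V - m C) / 2 by lra.
    have [_ [D [PD CD] <-] ltD] := sup_adherent gap supV.
    exists (exist _ D PD); split => // E PE CE.
    by have := ubV E PE CE; rewrite /=; lra.
  exists (exist _ C PC); split => // E PE CE.
  by have := ubV E PE CE; rewrite /=; lra.
have [f [f0 fS]] := dependent_choice step (exist _ A PA).
pose S n := sval (f n).
have PS n : P (S n) := svalP (f n).
have mS n : measurable (S n) := sP _ (PS n).
have SS n : S n `<=` S n.+1 by have [] := fS n.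
have PU := cP S PS SS.
exists (\bigcup_n S n); split => //.
  by move=> x Ax; exists 0%N; rewrite // /S f0.
move=> E PE UE.
have SU n : S n `<=` \bigcup_n S n by move=> x Sx; exists n.
have mU := sP _ PU.
have lim_mS : (mu \o S) n @[n --> \oo] --> mu (\bigcup_n S n).
  apply: nondecreasing_cvg_mu => //.
  by apply/nondecreasing_seqP => n; apply/subsetPset.
have : (mu (\bigcup_n S n) <= (2 * m (\bigcup_n S n) - m E)%:E)%E.
  rewrite -[leLHS](cvg_lim _ lim_mS)//; apply: lime_le.
    by apply/cvg_ex; eexists; apply: lim_mS.
  near=> n; rewrite /= measure_fineE// lee_fin.
  have [_ /(_ E PE)] := fS n.
  have := le_fine_measure (mS n.+1) mU (SU n.+1).
  rewrite -/(S n) -/(S n.+1) => ? /(_ (subset_trans (SU n) UE)); lra.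
rewrite (measure_fineE mU) lee_fin; lra.
Unshelve. all: by end_near. Qed.

End NullSets.

(** * Bases of a family of independent sets *)

Section BasesOfIndependents.
Variables (R : realType) (d : measure_display) (J : measurableType d).
Variable mu : {finite_measure set J -> \bar R}.
Implicit Types A B C X : set J.

Local Notation m A := (fine (mu A)).

Lemma bases_family (F : set (set J)) :
  measurable_family mu F -> measurable_family mu (bases mu F).
Proof.
move=> fF; have sF := fF.1; split=> [A [/sF]//|A B mA mB AB [FA maxA]].
have AsB : ae_subset mu A B.
  by apply: subset_measure0 AB; solve_measurable; apply: subsetUl.
have BsA : ae_subset mu B A.
  by apply: subset_measure0 AB; solve_measurable; apply: subsetUr.
split; first exact: family_ae_eq AsB BsA.
move=> C FC BC; have mC := sF _ FC.
apply: (ae_subset_trans mC mA mB _ AsB); apply: maxA => //.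
exact: ae_subset_trans AsB BC.
Qed.

(** (I4) is what makes exhaustion applicable.  The extension is inside [X]
    pointwise; a competitor is only almost inside [X], and is first cut down
    to [X]. *)
Lemma extend_maximal (F : set (set J)) X A : independence_axioms mu F ->
  measurable X -> F A -> A `<=` X ->
  exists M, [/\ maximal_in mu (family_within mu F X) M, A `<=` M & M `<=` X].
Proof.
move=> iF mX FA AX; have fF := indep_family iF; have sF := fF.1.
have [||//|M [[FM MX] AM maxM]] :=
  @exhaustion _ _ _ mu [set E | F E /\ E `<=` X] A.
- by move=> E [/sF].
- move=> S PS SS; split; last by move=> x [n _ Sx]; apply: (PS n).2.
  apply: (indep_I4 iF) => [i|i j ij]; first exact: (PS i).1.
  apply: ae_subset_sub; apply/subsetPset.
  by move: i j ij; apply/nondecreasing_seqP => n; apply/subsetPset.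
exists M; split => //; split=> [|C [FC CX] MC].
  by split=> //; apply: ae_subset_sub.
have mC := sF _ FC; have mM := sF _ FM.
have mE : measurable (M `|` (C `&` X)) by solve_measurable.
have FE : F (M `|` (C `&` X)).
  apply: (family_ae_eq fF FC) => //.
    apply: subset_measure0 CX; solve_measurable.
    by move=> x [Cx nE]; split=> // Xx; apply: nE; right.
  apply: subset_measure0 MC; solve_measurable.
  by move=> x [[Mx|[Cx Xx]] nC].
have EM : ae_subset mu (M `|` (C `&` X)) M.
  apply: ae_subset_eq_measure => //; first by apply: ae_subset_sub; apply: subsetUl.
  apply: maxM; last exact: subsetUl.
  by split=> // x [/MX//|[]].
apply: (subset_null2 _ _ _ _ EM CX); solve_measurable.
move=> x [Cx nM]; case: (pselect (X x)) => Xx; last by right.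
by left; split=> //; right.
Qed.

Section Matroid.
Variable F : set (set J).
Hypothesis iF : independence_axioms mu F.

Let fF := indep_family iF.
Let sF := (indep_family iF).1.

Lemma measurable_base B : bases mu F B -> measurable B.
Proof. by case=> /sF. Qed.

(** Specializing (I3) to the whole space speaks about bases. *)
Lemma bases_within_setT B :
  bases mu F B <-> maximal_in mu (family_within mu F setT) B.
Proof.
have subT A : ae_subset mu A setT by apply: ae_subset_sub; apply: subsetT.
split=> [[FB maxB]|[[FB _] maxB]]; split=> // C.
  by case=> FC _; apply: maxB.
by move=> FC; apply: maxB; split.
Qed.

Lemma eq_measure_bases B1 B2 :
  bases mu F B1 -> bases mu F B2 -> mu B1 = mu B2.
Proof.
by move=> /bases_within_setT ? /bases_within_setT; apply: indep_I3 measurableT _.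
Qed.

(** A base extending [A] has no more measure than [A], so it is [A] up to a
    null set. *)
Lemma base_of_measure A B : F A -> bases mu F B -> m B <= m A -> bases mu F A.
Proof.
move=> FA bB BA; have [M [/bases_within_setT bM AM _]] :=
  extend_maximal iF measurableT FA (@subsetT _ A).
have mA := sF FA; have mM := measurable_base bM.
have AsM : ae_subset mu A M by apply: ae_subset_sub.
apply: (family_ae_eq (bases_family fF) bM) => //.
by apply: ae_subset_eq_measure => //; rewrite (eq_measure_bases bM bB).
Qed.

Lemma bases_nonempty : bases mu F !=set0.
Proof.
have [M [/bases_within_setT bM _ _]] :=
  extend_maximal iF measurableT (indep_I1 iF) (@subsetT _ set0).
by exists M.
Qed.

(** The set exchanged for [X] is the part added to [B1 `\` X] by a maximal
    independent extension [M] inside [(B1 `\` X) `|` B2], in which [B2] is a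
    maximal independent set as well. *)
Lemma bases_exchange B1 B2 X : bases mu F B1 -> bases mu F B2 ->
  measurable X -> ae_subset mu X (B1 `\` B2) ->
  exists Y, [/\ measurable Y, ae_subset mu Y (B2 `\` B1),
    mu X = mu Y & bases mu F ((B1 `\` X) `|` Y)].
Proof.
move=> b1 b2 mX XB; have m1 := measurable_base b1; have m2 := measurable_base b2.
have mZ : measurable ((B1 `\` X) `|` B2) by solve_measurable.
have FX : F (B1 `\` X).
  apply: (indep_I2 iF _ _ b1.1); first by solve_measurable.
  by apply: ae_subset_sub; apply: subDsetl.
have [M [maxM XM MZ]] := extend_maximal iF mZ FX (@subsetUl _ _ _).
have mM : measurable M by case: maxM => -[/sF].
have max2 : maximal_in mu (family_within mu F ((B1 `\` X) `|` B2)) B2.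
  split; last by move=> C [FC _]; apply: b2.2.
  by split; [exact: b2.1 | apply: ae_subset_sub; apply: subsetUr].
have eM : mu M = mu B2 := indep_I3 iF mZ maxM max2.
exists (M `\` (B1 `\` X)); split.
- by solve_measurable.
- apply: subset_measure0 XB; solve_measurable.
  (* A point of the added part outside B2 minus B1 lies in both B1 and B2, and
     was hence removed with X, although X is almost disjoint from B2. *)
  move=> x [[Mx nX] nB]; case: (MZ _ Mx) => // B2x.
  have B1x : B1 x by apply: contrapT => nB1; apply: nB.
  have Xx : X x by apply: contrapT => nXx; apply: nX.
  by split=> // -[].
- apply: (eq_measure_fine mX); first by solve_measurable.
  have eMX : M `&` (B1 `\` X) = B1 `\` X by apply/setIidPr.
  have := fine_measure_split mu mM (measurableD m1 mX); rewrite eMX.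
  have := fine_measure_split mu m1 mX; have := fine_measure_split mu mX m1; rewrite setIC.
  have -> : m (X `\` B1) = 0.
    have -> // : mu (X `\` B1) = 0%E.
    apply: subset_measure0 XB; solve_measurable.
    by move=> x [Xx n1]; split=> // -[].
  rewrite eM (eq_measure_bases b2 b1); lra.
- rewrite setDUK//; apply: (base_of_measure _ b2); first by case: maxM => -[].
  by rewrite eM.
Qed.

(** All that the arguments by approximation use of convergence to zero. *)
Lemma fine_measure_cvg0 (S : nat -> set J) (e : R) : (forall n, measurable (S n)) ->
  (mu (S n) @[n --> \oo] --> 0)%E -> 0 < e -> exists n, m (S n) < e.
Proof.
move=> mS /fine_cvgP[_ /cvgrPdist_lt cS] e0.
have [N _ /(_ N (leqnn N))] := cS e e0.
by rewrite sub0r normrN ger0_norm ?fine_measure_ge0//; exists N.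
Qed.

(** Along a subsequence converging fast enough, the tail intersections of the
    approximants exhaust the limit, by Borel-Cantelli. *)
Lemma indep_limit (S : nat -> set J) A : (forall n, F (S n)) ->
  measurable A -> (mu (S n `+` A) @[n --> \oo] --> 0)%E -> F A.
Proof.
move=> FS mA SA; have mS n := sF (FS n).
have mSA n : measurable (S n `+` A) by rewrite /setY; solve_measurable.
have e0 k : 0 < 1 / (2 ^ k.+1)%:R :> R by rewrite divr_gt0// ltr0n expn_gt0.
have [u Hu] := choice (fun k => fine_measure_cvg0 mSA SA (e0 k)).
pose L k := A `\` S (u k).
have mL k : measurable (L k) by apply: measurableD.
have limL : mu (lim_sup_set L) = 0%E.
  apply: lim_sup_set_cvg0 => //.
  apply: (@le_lt_trans _ _ (\sum_(0 <= k <oo) (1 / (2 ^ k.+1)%:R)%:E)%E).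
    apply: lee_nneseries => // k _.
    have : (mu (L k) <= (1 / (2 ^ k.+1)%:R)%:E)%E; last by [].
    rewrite measure_fineE// lee_fin; apply: le_trans (ltW (Hu k)).
    by apply: le_fine_measure => //; apply: subsetUr.
  by apply: le_lt_trans (epsilon_trick0 _ ler01) _; rewrite ltry.
pose T k := A `&` \bigcap_(j in [set j | (k <= j)%N]) S (u j).
have mT k : measurable (T k).
  apply: measurableI => //; apply: bigcap_measurable => //.
  by exists k => /=.
have FT : F (\bigcup_k T k).
  apply: (indep_I4 iF) => [k|i j ij].
    apply: (indep_I2 iF (mT k) _ (FS (u k))); apply: ae_subset_sub.
    by move=> x [_ /(_ k)]; apply => /=.
  apply: ae_subset_sub => x [Ax Tx]; split=> // k /= jk.
  by apply: Tx => /=; apply: leq_trans jk.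
have mUT : measurable (\bigcup_k T k) by apply: bigcupT_measurable.
apply: (family_ae_eq fF FT) => //.
  by apply: ae_subset_sub => x [k _ []].
apply: subset_measure0 limL; first by solve_measurable.
  apply: bigcapT_measurable => k; apply: bigcup_measurable => j _; exact: mL.
move=> x [Ax nT] k _; apply: contrapT => nL; apply: nT; exists k => //.
split=> // j kj; apply: contrapT => nS; apply: nL; exists j => //.
Qed.

(** Measure is continuous for this convergence, so the limit has the common
    measure of the bases; being independent, it is a base. *)
Lemma bases_closed (S : nat -> set J) A : (forall n, bases mu F (S n)) ->
  measurable A -> (mu (S n `+` A) @[n --> \oo] --> 0)%E -> bases mu F A.
Proof.
move=> bS mA SA; have mS n := measurable_base (bS n).
have FA : F A by apply: (indep_limit _ mA SA) => n; apply: (bS n).1.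
apply: (base_of_measure FA (bS 0%N)); rewrite leNgt; apply/negP => lt0.
have gap : 0 < m (S 0%N) - m A by lra.
have mSA n : measurable (S n `+` A) by rewrite /setY; solve_measurable.
have [n ltn] := fine_measure_cvg0 mSA SA gap.
have := eq_measure_bases (bS 0%N) (bS n) => e0n; rewrite e0n in ltn.
have mSnA : measurable (S n `\` A) by apply: measurableD.
have := le_fine_measure mu mSnA (mSA n) (@subsetUl _ _ _).
have := le_fine_measure mu (measurableI _ _ (mS n) mA) mA (@subIsetr _ _ _).
have := fine_measure_split mu (mS n) mA; lra.
Qed.

Lemma bases_basis_axioms : basis_axioms mu (bases mu F).
Proof.
split; [exact: bases_family | exact: bases_nonempty | exact: bases_exchange |].
exact: bases_closed.
Qed.

End Matroid.
End BasesOfIndependents.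

(** * Independent sets generated by a family of bases *)

Section IndependentsOfBases.
Variables (R : realType) (d : measure_display) (J : measurableType d).
Variable mu : {finite_measure set J -> \bar R}.
Implicit Types A C D X Y : set J.

Local Notation m A := (fine (mu A)).

Variable B : set (set J).
Hypothesis bB : basis_axioms mu B.

Local Notation F := (generated_independents mu B).
Let fB := basis_family bB.
Let sB := (basis_family bB).1.

(** Cutting [Y] down to [D `\` C] only discards a null set. *)
Lemma strict_exchange C D X : B C -> B D -> measurable X -> X `<=` C `\` D ->
  exists Y, [/\ measurable Y, Y `<=` D `\` C, mu X = mu Y &
    B ((C `\` X) `|` Y)].
Proof.
move=> BC BD mX XC; have mC := sB BC; have mD := sB BD.
have [Y [mY YD XY BY]] := basis_B2 bB BC BD mX (ae_subset_sub mu XC).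
have mY' : measurable (Y `&` (D `\` C)) by solve_measurable.
exists (Y `&` (D `\` C)); split => //.
  apply: (eq_measure_fine mX mY'); rewrite XY.
  rewrite (fine_measure_split mu mY (measurableD mD mC)).
  by rewrite (YD : mu (Y `\` _) = 0%E) addr0.
apply: (family_ae_eq fB BY); first by solve_measurable.
  apply: subset_measure0 YD; solve_measurable.
  move=> x [[CXx|Yx] nx]; first by case: nx; left.
  by split=> // DCx; apply: nx; right.
by apply: ae_subset_sub => x [?|[? _]]; [left|right].
Qed.

(** Exchanging the whole of [C `\` D] finds a part of [D `\` C] of the same
    measure; by symmetry the two differences have equal measure. *)
Lemma eq_measure_members C D : B C -> B D -> mu C = mu D.
Proof.
have half C' D' : B C' -> B D' -> m (C' `\` D') <= m (D' `\` C').
  move=> BC BD; have mC := sB BC; have mD := sB BD.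
  have [Y [mY YD -> _]] :=
    strict_exchange BC BD (measurableD mC mD) (@subset_refl _ _).
  by apply: le_fine_measure => //; apply: measurableD.
move=> BC BD; have mC := sB BC; have mD := sB BD.
apply: eq_measure_fine => //.
have := half _ _ BC BD; have := half _ _ BD BC.
have := fine_measure_split mu mC mD; have := fine_measure_split mu mD mC; rewrite setIC; lra.
Qed.

Lemma generated_superset A : F A -> exists2 C, B C & A `<=` C.
Proof.
move=> [mA [C BC AC]]; have mC := sB BC; exists (C `|` A) => //.
apply: (family_ae_eq fB BC); first by solve_measurable.
  by apply: ae_subset_sub; apply: subsetUl.
apply: subset_measure0 AC; solve_measurable.
by move=> x [[Cx|Ax] nC].
Qed.

Lemma generatedS A C : measurable A -> A `<=` C -> B C -> F A.
Proof. by move=> mA AC BC; split=> //; exists C => //; apply: ae_subset_sub. Qed.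

Lemma generated_I2 A1 A2 :
  measurable A1 -> ae_subset mu A1 A2 -> F A2 -> F A1.
Proof.
move=> m1 A12 [m2 [C BC A2C]]; split=> //; exists C => //.
exact: ae_subset_trans m1 m2 (sB BC) A12 A2C.
Qed.

Lemma generated_family : measurable_family mu F.
Proof.
split=> [A []//|A1 A2 m1 m2 A12 F1]; apply: generated_I2 F1 => //.
by apply: subset_measure0 A12; rewrite /setY; solve_measurable; apply: subsetUr.
Qed.

Lemma bases_generated : bases mu F = B.
Proof.
apply/seteqP; split=> [A [FA maxA]|C BC].
  have [C BC AC] := generated_superset FA; have mC := sB BC.
  have AsC := ae_subset_sub mu AC.
  apply: (family_ae_eq fB BC) => //; first exact: FA.1.
  by apply: maxA => //; apply: generatedS BC.
have mC := sB BC; split; first exact: generatedS BC.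
move=> A [mA [D BD AD]] CA; have mD := sB BD.
apply: (ae_subset_trans mA mD mC AD).
apply: ae_subset_eq_measure => //; first exact: ae_subset_trans CA AD.
by rewrite (eq_measure_members BC BD).
Qed.

(** Comparing measures, and only for traces that contain [C `&` X] pointwise,
    is the form of maximality to which [exchange_outside] appeals. *)
Definition max_trace X C := forall D, B D -> C `&` X `<=` D ->
  m (D `&` X) <= m (C `&` X).

(** The trace on [X] of a member of [B] containing [A] is independent and
    contains [A], so a maximal [A] is such a trace. *)
Lemma maximal_trace X A : measurable X ->
  maximal_in mu (family_within mu F X) A ->
  exists C, [/\ B C, mu A = mu (C `&` X) & max_trace X C].
Proof.
move=> mX [[FA AX] maxA]; have mA := FA.1.
have [C BC AC] := generated_superset FA; have mC := sB BC.
have trace D : B D -> ae_subset mu A D -> m (D `&` X) <= m A.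
  move=> BD AD; have mD := sB BD.
  have mDX : measurable (D `&` X) by apply: measurableI.
  apply: le_fine_measure_ae => //; apply: maxA.
    split; last by apply: ae_subset_sub; apply: subIsetr.
    by apply: generatedS BD => //; apply: subIsetl.
  apply: (subset_null2 _ _ _ _ AD AX); solve_measurable.
  move=> x [Ax nDX]; case: (pselect (D x)) => Dx; last by left.
  by right; split=> // Xx; apply: nDX.
have mCX : measurable (C `&` X) by apply: measurableI.
have sACX : ae_subset mu A (C `&` X).
  apply: subset_measure0 AX; solve_measurable.
  by move=> x [Ax nCX]; split=> // Xx; apply: nCX; split=> //; apply: AC.
have eA : mu A = mu (C `&` X).
  apply: eq_measure_fine => //; apply/eqP; rewrite eq_le le_fine_measure_ae//=.
  by apply: trace => //; apply: ae_subset_sub.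
exists C; split=> // D BD CXD; rewrite -eA; apply: trace => //.
have mD := sB BD; apply: (ae_subset_trans mA mCX mD sACX).
exact: ae_subset_sub.
Qed.

(** Removing from [C] only points outside [X] keeps its trace, so maximality
    leaves no room in [X] for the set received in exchange. *)
Lemma exchange_outside X C D : measurable X -> B C -> B D -> max_trace X C ->
  m (C `\` (D `|` X)) <= m (D `\` (C `|` X)).
Proof.
move=> mX BC BD maxC; have mC := sB BC; have mD := sB BD.
have mO : measurable (C `\` (D `|` X)) by solve_measurable.
have [|Y [mY YD -> BY]] := strict_exchange BC BD mO.
  by move=> x [Cx nDX]; split=> // Dx; apply: nDX; left.
have mE := sB BY.
have mCX : measurable (C `&` X) by apply: measurableI.
have mYX : measurable (Y `&` X) by apply: measurableI.
set E := _ `|` Y in BY mE.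
have YX0 : mu (Y `&` X) = 0%E.
  have CXE : C `&` X `<=` E.
    by move=> x [Cx Xx]; left; split=> // -[_]; apply; right.
  have := maxC E BY CXE.
  have := fine_measure_split mu (measurableI _ _ mE mX) mC => ->.
  have -> : E `&` X `&` C = C `&` X.
    apply/seteqP; split=> [x [[_ Xx] Cx]//|x [Cx Xx]].
    by split=> //; split=> //; apply: CXE.
  move=> EC; apply: null_fine_measure => //.
  have : m (Y `&` X) <= m (E `&` X `\` C).
    apply: le_fine_measure; solve_measurable.
    move=> x [Yx Xx]; split; first by split=> //; right.
    by have [] := YD _ Yx.
  lra.
apply: le_fine_measure_ae; solve_measurable.
apply: subset_measure0 YX0; solve_measurable.
move=> x [Yx nx]; split=> //; apply: contrapT => nX; apply: nx.
by have [Dx nC] := YD _ Yx; split=> // -[].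
Qed.

(** As [C] and [D] have equal measure and share [C `&` D `\` X], equality of
    the parts compared by [exchange_outside] means equality of the traces. *)
Lemma generated_I3 X A1 A2 : measurable X ->
  maximal_in mu (family_within mu F X) A1 ->
  maximal_in mu (family_within mu F X) A2 -> mu A1 = mu A2.
Proof.
move=> mX max1 max2.
have [C [BC -> maxC]] := maximal_trace mX max1.
have [D [BD -> maxD]] := maximal_trace mX max2.
have mC := sB BC; have mD := sB BD.
apply: eq_measure_fine; [exact: measurableI|exact: measurableI|].
have := exchange_outside mX BC BD maxC.
have := exchange_outside mX BD BC maxD.
have := fine_measure_split mu mC mX; have := fine_measure_split mu mD mX.
have := fine_measure_split mu (measurableD mC mX) mD.
have := fine_measure_split mu (measurableD mD mX) mC.
have := eq_measure_members BC BD => ->.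
have -> : (D `\` X) `&` C = (C `\` X) `&` D by apply/seteqP; split=> x [[? ?] ?].
rewrite !setDDl ![X `|` _]setUC; lra.
Qed.

(** In a member of [B] containing [A2], everything outside [C] and [A2] can be
    exchanged for points of [C]; beyond [A2] only points of [C] remain. *)
Lemma adapt_superset C A1 A2 : B C -> A1 `<=` A2 -> F A2 ->
  exists D, [/\ B D, A2 `<=` D & D `\` A2 `<=` C `\` A1].
Proof.
move=> BC A12 F2; have m2 := F2.1.
have [D BD A2D] := generated_superset F2; have mC := sB BC; have mD := sB BD.
have mX : measurable (D `\` (C `|` A2)) by solve_measurable.
have [|Y [mY YC _ BY]] := strict_exchange BD BC mX.
  by move=> x [Dx n]; split=> // Cx; apply: n; left.
exists (D `\` (D `\` (C `|` A2)) `|` Y); split=> //.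
  by move=> x A2x; left; split; [exact: A2D|case=> _; apply; right].
move=> x [[[Dx nX]|Yx] nA2]; split; try by move=> /A12.
  by apply: contrapT => nC; apply: nX; split=> // -[].
by have [] := YC _ Yx.
Qed.

(** With decreasing remainders [C n `\` A n], the difference between [C n] and
    the limit lies in [E n], a decreasing sequence of sets with empty
    intersection, so continuity from above gives the convergence that (B3)
    needs. *)
Lemma generated_bigcup (A : nat -> set J) : (forall n, F (A n)) ->
  (forall n, A n `<=` A n.+1) -> F (\bigcup_n A n).
Proof.
move=> FA A_incr; have mA n : measurable (A n) := (FA n).1.
have step (nC : {nC : nat * set J | B nC.2 /\ A nC.1 `<=` nC.2}) :
    {nD : {nD : nat * set J | B nD.2 /\ A nD.1 `<=` nD.2} |
      (sval nD).1 = (sval nC).1.+1 /\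
      (sval nD).2 `\` A (sval nD).1 `<=` (sval nC).2 `\` A (sval nC).1}.
  (* The index travels with the set because each step depends on it. *)
  apply: cid; case: nC => -[n C] /= [BC AC].
  have [D [BD AD DC]] := adapt_superset BC (A_incr n) (FA n.+1).
  by exists (exist _ (n.+1, D) (conj BD AD)).
have [C0 BC0 AC0] := generated_superset (FA 0%N).
have [f [f0 fS]] := dependent_choice step (exist _ (0%N, C0) (conj BC0 AC0)).
pose C n := (sval (f n)).2.
have idx n : (sval (f n)).1 = n.
  by elim: n => [|n IH]; [rewrite f0 | rewrite (fS n).1 IH].
have BC n : B (C n) by rewrite /C; have [] := svalP (f n).
have AC n : A n `<=` C n.
  by have [_] := svalP (f n); rewrite idx.
have CS n : C n.+1 `\` A n.+1 `<=` C n `\` A n.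
  by have [_] := fS n; rewrite !idx.
have mC n : measurable (C n) := sB (BC n).
set U := \bigcup_n A n.
have mU : measurable U by apply: bigcupT_measurable.
have AU n : A n `<=` U by move=> x Ax; exists n.
pose K := \bigcap_n (C n `\` A n).
have mK : measurable K.
  by apply: bigcapT_measurable => n; apply: measurableD.
pose E n := (U `\` A n) `|` ((C n `\` A n) `\` K).
have mE n : measurable (E n) by rewrite /E; solve_measurable.
have capE : \bigcap_n E n = set0.
  apply/seteqP; split=> // x Ex.
  case: (pselect (U x)) => [[k _ Akx]|nU].
    by case: (Ex k I) => [[_ /(_ Akx)]|[[_ /(_ Akx)]]].
  have CAx n : (C n `\` A n) x /\ ~ K x by case: (Ex n I) => [[]|].
  by apply: (CAx 0%N).2 => n _; apply: (CAx n).1.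
have cvgE : (mu (E n) @[n --> \oo] --> 0)%E.
  have <- : mu (\bigcap_n E n) = 0%E by rewrite capE measure0.
  apply: (@nonincreasing_cvg_mu _ _ _ mu E) => //.
  - by rewrite ltey_eq fin_num_measure.
  - by rewrite capE.
  - apply/nonincreasing_seqP => n; apply/subsetPset => x [[Ux nA]|[CAx nK]].
      by left; split=> // /A_incr.
    by right; split=> //; apply: CS.
have BU : B (U `|` K).
  apply: (basis_B3 bB BC); first exact: measurableU.
  apply: (squeeze_cvge _ (cvg_cst 0%E) cvgE); apply: nearW => n.
  rewrite measure_ge0 /=; apply: le_measure; rewrite ?inE //.
    by rewrite /setY; solve_measurable.
  move=> x [[Cx nUK]|[UKx nC]].
    right; split; last by move=> Kx; apply: nUK; right.
    by split=> // /AU Ux; apply: nUK; left.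
  case: UKx => [Ux|Kx]; last by case: (Kx n).
  by left; split=> // /AC.
exact: generatedS (@subsetUl _ _ _) BU.
Qed.

(** Replacing [A n] by the finite union of its predecessors changes it by a null
    set only, and makes the sequence pointwise increasing. *)
Lemma generated_I4 (A : nat -> set J) : (forall i, F (A i)) ->
  (forall i j, (i <= j)%N -> ae_subset mu (A i) (A j)) -> F (\bigcup_i A i).
Proof.
move=> FA incA; have mA n : measurable (A n) := (FA n).1.
pose P n := \bigcup_(i in [set i | (i <= n)%N]) A i.
have mP n : measurable (P n) by apply: bigcup_measurable.
have -> : \bigcup_i A i = \bigcup_n P n.
  apply/seteqP; split=> [x [i _ Ax]|x [n _ [i _ Ax]]]; last by exists i.
  by exists i => //; exists i => /=.
apply: generated_bigcup => n; last first.
  by move=> x [i /= in_ Ax]; exists i => //=; apply: leq_trans in_ _.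
apply: (generated_I2 (mP n) _ (FA n)).
apply/negligibleP; first exact: measurableD.
have -> : P n `\` A n = \bigcup_(i in [set i | (i <= n)%N]) (A i `\` A n).
  apply/seteqP; split=> [x [[i in_ Ax] nA]|x [i in_ [Ax nA]]].
    by exists i.
  by split=> //; exists i.
rewrite bigcup_mkcond; apply: negligible_bigcup => i.
case: ifPn => [|_]; last exact: negligible_set0.
rewrite inE => /= in_; apply/negligibleP; first exact: measurableD.
exact: incA.
Qed.

Lemma generated_independence : independence_axioms mu F.
Proof.
split; [exact: generated_family | | exact: generated_I2 | exact: generated_I3 |
        exact: generated_I4].
by have [C BC] := basis_B1 bB; apply: generatedS (@sub0set _ _) BC.
Qed.

End IndependentsOfBases.

(** * The equivalence of the two axiom systems *)

Theorem theorem2p13 (R : realType) (d : measure_display)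
    (J : measurableType d) (mu : {finite_measure set J -> \bar R}) :
  (forall F : set (set J),
     measurable_matroid mu F -> basis_axioms mu (bases mu F)) /\
  (forall B : set (set J),
     standard_measure_space mu -> basis_axioms mu B ->
     [/\ independence_axioms mu (generated_independents mu B),
         measurable_matroid mu (generated_independents mu B) &
         bases mu (generated_independents mu B) = B]).
Proof.
split=> [F [_ iF]|B stdJ bB]; first exact: bases_basis_axioms.
have iB := generated_independence bB.
by split=> //; apply: bases_generated.
Qed.
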